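(* Let $V$ and $W$ be (not necessarily independent) random variables taking values in $\mathbb{Z}_+=\{0,1,2,\dots\}$. Suppose that $V$ is log-concave. Let $p_{W|V}(w|v)$ be the conditional mass function of $W$ given $V$, and for integers $i,r,s\ge 0$ put $$a^{(i)}_{r,s} = p_{W|V}(i-r|r)\,p_{W|V}(i-s|s) - p_{W|V}(i-r-1|r)\,p_{W|V}(i-s+1|s).$$ Suppose that for all integers $i,m,t$ with $0\le t\le m\le i$, $$\text{(a)}\quad \sum_{k=-t}^{t} a^{(i)}_{m+k,\,m-k}\ \ge 0 \qquad\text{and}\qquad \text{(b)}\quad \sum_{k=-t-1}^{t} a^{(i)}_{m+k+1,\,m-k}\ \ge 0 .$$ Then $V+W$ is log-concave.
   Context: A random variable $X$ with values in $\mathbb{Z}_+$ is called log-concave if its mass function $p_X(i)=\mathbb{P}(X=i)$ satisfies $p_X(i)^2\ge p_X(i-1)p_X(i+1)$ for all $i\ge 1$. The conditional mass function $p_{W|V}(w|v)$ is an array of non-negative numbers, indexed by $v\in\mathbb{Z}_+$ and $w\in\mathbb{Z}$, with $\mathbb{P}(V=v,W=w)=\mathbb{P}(V=v)\,p_{W|V}(w|v)$ for all $v,w\ge 0$, and $p_{W|V}(w|v)=0$ whenever $w<0$. For those $v$ with $\mathbb{P}(V=v)=0$, the numbers $p_{W|V}(w|v)$, $w\ge 0$, may be any fixed non-negative numbers. In particular $\mathbb{P}(V+W=x)=\sum_{v=0}^{x}\mathbb{P}(V=v)\,p_{W|V}(x-v|v)$.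
   Formalization: It is additionally assumed that the mass function of V has no internal zeros (its support is an interval); with only the inequalities p(i)^2 ≥ p(i-1)p(i+1) the claim fails, e.g. V uniform on {0,3}, W=1 if V=0 and W=0 if V=3. *)

(* Defs.v *)
From mathcomp Require Import all_boot all_order all_algebra.
From mathcomp Require Import all_classical all_reals all_analysis.

Set Implicit Arguments.
Unset Strict Implicit.
Unset Printing Implicit Defensive.

Import Order.TTheory GRing.Theory Num.Theory.
Local Open Scope classical_set_scope.
Local Open Scope ring_scope.

(* The library's [pmf] is for real-valued random variables only. *)
Definition mass (d : measure_display) (T : measurableType d) (R : realType)
    (P : probability T R) (X : T -> nat) (i : nat) : R :=
  fine (P (X @^-1` [set i])).

Definition log_concave (d : measure_display) (T : measurableType d)
    (R : realType) (P : probability T R) (X : T -> nat) : Prop :=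
  forall i : nat, (1 <= i)%N ->
    mass P X i.-1 * mass P X i.+1 <= mass P X i ^+ 2.

(* [log_concave] alone allows internal zeros (e.g. the uniform law on {0, 3});
   this is the usual contiguous-support convention, kept separate. *)
Definition no_internal_zeros (d : measure_display) (T : measurableType d)
    (R : realType) (P : probability T R) (X : T -> nat) : Prop :=
  forall i j k : nat, (i <= j <= k)%N ->
    0 < mass P X i -> 0 < mass P X k -> 0 < mass P X j.

(* [q w v] stands for p_{W|V}(w|v).  The values [q w v] with [0 <= w] and
   [P(V = v) = 0] are only required to be nonnegative. *)
Definition is_cond_mass (d : measure_display) (T : measurableType d)
    (R : realType) (P : probability T R) (V W : T -> nat)
    (q : int -> nat -> R) : Prop :=
  [/\ forall (w : int) (v : nat), 0 <= q w v,
      forall (w : int) (v : nat), w < 0 -> q w v = 0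
    & forall v w : nat,
        fine (P (V @^-1` [set v] `&` W @^-1` [set w])) = mass P V v * q w%:Z v].

(* The subtractions are in [int], so the first argument of [q] may be negative. *)
Definition acoef (R : realType) (q : int -> nat -> R) (i r s : nat) : R :=
  q (i%:Z - r%:Z) r * q (i%:Z - s%:Z) s
  - q (i%:Z - r%:Z - 1) r * q (i%:Z - s%:Z + 1) s.

(* The sum over -t <= k <= t of a^(i)_{m+k, m-k}, with k = j - t. *)
Definition even_sum (R : realType) (q : int -> nat -> R) (i m t : nat) : R :=
  \sum_(0 <= j < t.*2.+1) acoef q i (m + j - t)%N (m + t - j)%N.

(* The sum over -t-1 <= k <= t of a^(i)_{m+k+1, m-k}, with k = j - t - 1. *)
Definition odd_sum (R : realType) (q : int -> nat -> R) (i m t : nat) : R :=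
  \sum_(0 <= j < t.*2.+2) acoef q i (m + j - t)%N (m + t.+1 - j)%N.

(* Main.v *)
Require Import Defs.
From mathcomp Require Import all_boot all_order all_algebra.
From mathcomp Require Import all_classical all_reals all_analysis.
From mathcomp Require Import zify ring lra.

(** Write [p] for the mass function of [V], and [s n] for
    [\sum_v p v * q (n - v) v], the mass of [V + W] at [n].  Expanding products,
      [s i ^+ 2 - s (i - 1) * s (i + 1) = \sum_(r, s) p r * p s * a^(i)_(r, s)],
    and [a^(i)_(r, s)] vanishes as soon as [r + s > 2 i], because each of its
    two products then has a [q] factor with a negative argument
    ([acoef_eq0]).  Hence the right-hand side is a sum over the antidiagonals
    [r + s = n] with [n <= 2 i + 1], and it suffices to show that each
    antidiagonal contributes a nonnegative amount.

    On the antidiagonal [r + s = n] the weight [p r * p (n - r)] is symmetric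
    under [r |-> n - r] and, since [p] is log-concave without internal zeros,
    it increases as [r] approaches the middle
    ([log_concave_seq_mul_le]).  The two hypotheses on the sums of [a^(i)] say
    that [a^(i)] has a nonnegative sum over every centred window of the
    antidiagonal, for [n] even and [n] odd respectively.  Summation by parts
    writes a symmetric unimodal weight as a nonnegative combination of
    indicators of centred windows, so these sums are all that is needed
    ([sum_unimodal_weight_ge0]). *)

Import Order.TTheory GRing.Theory Num.Theory.
Local Open Scope ring_scope.

(** Log-concavity only compares neighbours; the gap is widened one step at a
    time by multiplying consecutive inequalities.  Passing from [b] to [b.+1]
    divides by [p b * p b.+1]; if one of these two vanishes, the absence of
    internal zeros forces the left-hand side [p a * p b.+2] to vanish. *)
Lemma log_concave_seq_mul_le (R : realFieldType) (p : nat -> R)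
    (p_ge0 : forall i, 0 <= p i)
    (p_lc : forall i, (1 <= i)%N -> p i.-1 * p i.+1 <= p i ^+ 2)
    (p_niz : forall i j k, (i <= j <= k)%N -> 0 < p i -> 0 < p k -> 0 < p j)
    (a b : nat) :
  (a < b)%N -> p a * p b.+1 <= p a.+1 * p b.
Proof.
have vanish i j k : (i <= j <= k)%N -> p j = 0 -> p i * p k = 0.
  move=> ijk pj0; apply/eqP; rewrite mulf_eq0; apply/negPn/negP.
  rewrite negb_or !neq_lt !ltNge !p_ge0 /= -!ltNge => /andP[pi pk].
  by have := p_niz i j k ijk pi pk; rewrite pj0 ltxx.
elim: b => // b IHb; rewrite ltnS leq_eqVlt => /predU1P[->|ab].
  by have := p_lc b.+1 isT; rewrite expr2.
have {}IHb := IHb ab.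
have [pb0|pb0] := eqVneq (p b) 0.
  by rewrite (vanish a b) ?mulr_ge0 ?pb0 //; lia.
have [pb1|pb1] := eqVneq (p b.+1) 0.
  by rewrite (vanish a b.+1) ?mulr_ge0 ?pb1 //; lia.
have gt0 : 0 < p b * p b.+1 by rewrite mulr_gt0 // lt0r ?pb0 ?pb1 p_ge0.
rewrite -(ler_pM2r gt0).
have := ler_pM (mulr_ge0 (p_ge0 _) (p_ge0 _)) (mulr_ge0 (p_ge0 _) (p_ge0 _))
  IHb (p_lc b.+1 isT); rewrite /=.
have -> : p a * p b.+1 * (p b * p b.+2) = p a * p b.+2 * (p b * p b.+1) by ring.
by have -> : p a.+1 * p b * p b.+1 ^+ 2 = p a.+1 * p b.+1 * (p b * p b.+1) by ring.
Qed.

(** Summation by parts.  Enlarging the window by one point on each side adds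
    the two end values with a common weight that is at most the weights used
    so far, so the weighted sum stays above the smallest weight times the
    plain sum; this is the bound carried by the induction.  The window of
    radius [t] is [[n./2 - t, n - n./2 + t]]: its centre is one point or two,
    according to the parity of [n]. *)
Lemma sum_unimodal_weight_ge0 (R : realDomainType) (n : nat) (w f : nat -> R)
    (w_ge0 : forall r, 0 <= w r)
    (w_sym : forall r, (r <= n)%N -> w (n - r)%N = w r)
    (w_incr : forall r, (r < n./2)%N -> w r <= w r.+1)
    (f_window : forall t, (t <= n./2)%N ->
      0 <= \sum_(n./2 - t <= r < (n - n./2 + t).+1) f r) :
  0 <= \sum_(0 <= r < n.+1) w r * f r.
Proof.
set m := n./2 in w_incr f_window.
have mn : (m.*2 <= n <= m.*2.+1)%N by rewrite /m; lia.
have bound t : (t <= m)%N ->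
    w (m - t)%N * \sum_(m - t <= r < (n - m + t).+1) f r
    <= \sum_(m - t <= r < (n - m + t).+1) w r * f r.
  elim: t => [_|t IHt tm].
    (* every point of the central window has the weight of [m] *)
    rewrite subn0 addn0 mulr_sumr le_eqVlt; apply/orP; left; apply/eqP.
    apply: eq_big_nat => r /andP[mr rn]; congr (_ * _).
    have [->//|rm] := eqVneq r m.
    have nrm : (n - r = m)%N by lia.
    by rewrite -nrm w_sym //; lia.
  have extend (g : nat -> R) :
      \sum_(m - t.+1 <= r < (n - m + t.+1).+1) g r
      = g (m - t.+1)%N + g (n - (m - t.+1))%N
        + \sum_(m - t <= r < (n - m + t).+1) g r.
    have -> : ((n - m + t.+1) = (n - m + t).+1)%N by lia.
    rewrite big_nat_recr /=; last by lia.
    rewrite big_ltn; last by lia.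
    rewrite (_ : (m - t.+1).+1 = m - t)%N; last by lia.
    rewrite (_ : (n - m + t).+1 = n - (m - t.+1))%N; last by lia.
    by rewrite -addrA [X in _ + X]addrC addrA.
  rewrite !extend w_sym; last by lia.
  have {}IHt := IHt (ltnW tm).
  have W0 := f_window t (ltnW tm).
  have := w_incr (m - t.+1)%N; rewrite (_ : (m - t.+1).+1 = m - t)%N; last by lia.
  move=> /(_ ltac:(lia)) wle.
  by have := ler_wpM2r W0 wle; lra.
have := bound m (leqnn m); rewrite subnn (_ : n - m + m = n)%N; last by lia.
apply: le_trans; rewrite mulr_ge0 //.
by have := f_window m (leqnn m); rewrite subnn (_ : n - m + m = n)%N //; lia.
Qed.

Lemma sum_square_antidiagonals (V : nmodType) (N : nat) (F : nat -> nat -> V) :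
    (forall r s, (N <= r + s)%N -> F r s = 0) ->
  \sum_(0 <= r < N) \sum_(0 <= s < N) F r s
  = \sum_(0 <= n < N) \sum_(0 <= r < n.+1) F r (n - r)%N.
Proof.
move=> F0; symmetry.
transitivity (\sum_(0 <= n < N) \sum_(0 <= r < N | (r <= n)%N) F r (n - r)%N).
  apply: eq_big_nat => n /andP[_ nN].
  by rewrite (big_nat_widen _ _ N).
rewrite (exchange_big_dep_nat xpredT) //=.
apply: eq_big_nat => r /andP[_ rN].
rewrite -(big_nat_widenl r 0 N xpredT) // -{1}[r]add0n big_addn.
rewrite [RHS](big_cat_nat _ (n := (N - r)%N)) ?leq_subr //=.
rewrite [X in _ + X]big_nat_cond [X in _ + X]big1 ?addr0 => [|s]; last first.
  by move=> /andP[/andP[? ?] _]; apply: F0; lia.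
by apply: eq_big_nat => s _; rewrite addnK.
Qed.

Lemma mass_ge0 (d : measure_display) (T : measurableType d) (R : realType)
    (P : probability T R) (X : T -> nat) (i : nat) : 0 <= mass P X i.
Proof. exact/fine_ge0/measure_ge0. Qed.

(** The events [V = v] and [W = n - v] with [v <= n] partition [V + W = n].
    Values [v > n] contribute nothing, [q] being zero at negative arguments;
    they are allowed so that the masses at different [n] can all be summed
    over a common range. *)
Lemma mass_add (d : measure_display) (T : measurableType d) (R : realType)
    (P : probability T R) (V W : {RV P >-> nat}) (q : int -> nat -> R)
    (q_cond_mass : is_cond_mass P V W q) (n N : nat) :
  (n < N)%N ->
  mass P (fun x => (V x + W x)%N) n
  = \sum_(0 <= v < N) mass P V v * q (n%:Z - v%:Z) v.
Proof.
case: q_cond_mass => _ q_neg q_joint nN.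
pose E v := (V @^-1` [set v] `&` W @^-1` [set (n - v)%N])%classic.
have mE v : measurable (E v).
  by apply: measurableI; apply: measurable_funPTI.
have event : ((fun x => V x + W x)%N @^-1` [set n])%classic
    = \big[setU/set0]_(v < n.+1) E v.
  rewrite -bigcup_mkord; apply/seteqP; split => x /=.
    move=> VWn; exists (V x); rewrite /E /= -VWn ?addKn //.
    by rewrite ltnS leq_addr.
  by case=> v; rewrite /= ltnS => vn [-> ->]; rewrite subnKC.
rewrite /mass event measure_bigsetU_ord //; last first.
  by move=> u v _ _ [x [[Vu _] [Vv _]]]; apply: val_inj; rewrite /= -Vu -Vv.
rewrite -sum_fine => [|v _]; last exact: fin_num_measure.
rewrite [RHS](big_cat_nat _ (n := n.+1)) //=.
rewrite [X in _ + X]big_nat_cond [X in _ + X]big1 ?addr0 => [|v]; last first.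
  by move=> /andP[/andP[? ?] _]; rewrite q_neg ?mulr0 //; lia.
rewrite big_mkord; apply: eq_bigr => v _; rewrite q_joint; congr (_ * q _ _).
by have := ltn_ord v; lia.
Qed.

Lemma acoef_eq0 (R : realType) (q : int -> nat -> R) (i r s : nat) :
    (forall (w : int) (v : nat), w < 0 -> q w v = 0) ->
  (i.*2 < r + s)%N -> acoef q i r s = 0.
Proof.
move=> q0 irs; rewrite /acoef.
have -> : q (i%:Z - r%:Z) r * q (i%:Z - s%:Z) s = 0.
  have [ir|ri] := ltnP i r; first by rewrite q0 ?mul0r //; lia.
  by rewrite [X in _ * X]q0 ?mulr0 //; lia.
rewrite sub0r; have [ir|ri] := leqP i r; first by rewrite q0 ?mul0r ?oppr0 //; lia.
by rewrite [X in _ * X]q0 ?mulr0 ?oppr0 //; lia.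
Qed.

(** Both families of hypotheses have the same form on an antidiagonal: which
    one is used depends on the parity of [n]. *)
Lemma acoef_window_ge0 (R : realType) (q : int -> nat -> R) (i n t : nat)
    (cond_a : forall m t : nat, (t <= m <= i)%N -> 0 <= even_sum q i m t)
    (cond_b : forall m t : nat, (t <= m <= i)%N -> 0 <= odd_sum q i m t) :
  (n < i.+1.*2)%N -> (t <= n./2)%N ->
  0 <= \sum_(n./2 - t <= r < (n - n./2 + t).+1) acoef q i r (n - r)%N.
Proof.
move=> ni tn; rewrite -[X in \sum_(X <= _ < _) _]add0n big_addn.
have tni : (t <= n./2 <= i)%N by lia.
have [odd_n|even_n] := boolP (odd n).
  have := cond_b _ _ tni; rewrite /odd_sum; congr (0 <= _).
  rewrite (_ : (_ - _ = t.*2.+2)%N); last by lia.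
  by apply: eq_big_nat => j jt; congr acoef; lia.
have := cond_a _ _ tni; rewrite /even_sum; congr (0 <= _).
rewrite (_ : (_ - _ = t.*2.+1)%N); last by lia.
by apply: eq_big_nat => j jt; congr acoef; lia.
Qed.

Theorem theorem1p5 (d : measure_display) (T : measurableType d) (R : realType)
    (P : probability T R) (V W : {RV P >-> nat}) (q : int -> nat -> R)
    (V_log_concave : log_concave P V)
    (V_no_internal_zeros : no_internal_zeros P V)
    (q_cond_mass : is_cond_mass P V W q)
    (cond_a : forall i m t : nat, (t <= m <= i)%N -> 0 <= even_sum q i m t)
    (cond_b : forall i m t : nat, (t <= m <= i)%N -> 0 <= odd_sum q i m t) :
  log_concave P (fun x => (V x + W x)%N).
Proof.
move=> i i_gt0; have [_ q_neg _] := q_cond_mass.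
have p_ge0 := @mass_ge0 _ _ _ P V.
have p_mul_le := log_concave_seq_mul_le _ _ p_ge0 V_log_concave V_no_internal_zeros.
(* with this common range of summation, the pairs left out of the triangle
   [r + s < N] are exactly those with [r + s > 2 i + 1], where [acoef] vanishes *)
pose N := i.+1.*2; set p := mass P V in p_ge0 p_mul_le.
rewrite !(mass_add _ _ _ _ _ _ _ q_cond_mass _ N); [|rewrite /N; lia..].
rewrite -/p -subr_ge0 expr2 !big_distrlr /= -sumrB.
under eq_bigr do rewrite -sumrB.
rewrite (_ : \sum_(0 <= r < N) _ =
    \sum_(0 <= r < N) \sum_(0 <= s < N) p r * p s * acoef q i r s); last first.
  apply: eq_bigr => r _; apply: eq_bigr => s _; rewrite /acoef.
  rewrite (_ : i.-1%:Z - r%:Z = i%:Z - r%:Z - 1); last by lia.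
  rewrite (_ : i.+1%:Z - s%:Z = i%:Z - s%:Z + 1); last by lia.
  by ring.
rewrite sum_square_antidiagonals => [|r s Nrs]; last first.
  by rewrite acoef_eq0 ?mulr0 //; rewrite /N in Nrs; lia.
rewrite big_nat_cond; apply: sumr_ge0 => n /andP[/andP[_ nN] _].
apply: (sum_unimodal_weight_ge0 _ n (fun r => p r * p (n - r)%N)
  (fun r => acoef q i r (n - r)%N)) => [r|r rn|r rn|t tn].
- exact: mulr_ge0.
- by rewrite subKn // mulrC.
- have := p_mul_le r (n - r.+1)%N; rewrite (_ : (n - r.+1).+1 = n - r)%N; last by lia.
  by apply; lia.
- by apply: acoef_window_ge0 => //; auto.
Qed.
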